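(* Let $r\ge 2$, and let $\mathcal A$, $\mathcal I$, $\mathcal R=\mathcal A/\mathcal I$, $\mathcal B_{\rm irr}$, $\mathcal A_{\rm irr}$ and the reduction $E\mapsto[E]$ be as defined in the context. Then: (1) a set of representatives in $\mathcal A$ for $\mathcal R$ is given by the $\mathbb Z$-module $\mathcal A_{\rm irr}$ of irreducible expressions, i.e. every class of $\mathcal A$ modulo $\mathcal I$ contains exactly one element of $\mathcal A_{\rm irr}$; (2) the algebra $\mathcal R$ may be identified with the $\mathbb Z$-module $\mathcal A_{\rm irr}$, the multiplication being given by $(E,F)\mapsto [E\times F]$ for any two irreducible expressions $E,F$ (where $E\times F$ inside the brackets is the product in $\mathcal A$); (3) with this identification, $\mathcal B_{\rm irr}$ is a basis for $\mathcal R$.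
   Context: Fix an integer $r\ge 2$ and the alphabet $\mathbb A=\{1,2,\dots,r\}$. A biword is a $2\times n$ matrix $\alpha=\binom{x_1\cdots x_n}{a_1\cdots a_n}$ ($n\ge 0$) with entries in $\mathbb A$; $\ell(\alpha)=n$ is its length. It is viewed as the word $\binom{x_1}{a_1}\cdots\binom{x_n}{a_n}$ in the biletters $\binom{x}{a}$, $x,a\in\mathbb A$. The product of biwords is concatenation; the empty biword is the unit $1$. $\mathcal B$ is the set of all biwords. A biword has a double descent at position $i$ ($1\le i\le n-1$) if $x_i>x_{i+1}$ and $a_i\ge a_{i+1}$. A biword without any double descent is irreducible; $\mathcal B_{\rm irr}$ is the set of irreducible biwords. $\mathcal A=\mathbb Z\langle\langle\mathcal B\rangle\rangle$ is the $\mathbb Z$-algebra of all (possibly infinite) formal sums (''expressions'') $\sum_{\alpha\in\mathcal B}c(\alpha)\alpha$, $c(\alpha)\in\mathbb Z$, with product induced by concatenation. $\mathbb Z\langle\mathcal B\rangle\subset\mathcal A$ is the subalgebra of finite sums. An expression is irreducible if $c(\alpha)=0$ for all $\alpha\notin\mathcal B_{\rm irr}$; $\mathcal A_{\rm irr}$ is the set of all irreducible expressions. For $n\ge0$, $E^{(n)}=\sum_{\ell(\alpha)=n}c(\alpha)\alpha$ is the degree-$n$ homogeneous component of $E=\sum_\alpha c(\alpha)\alpha$; it is a finite sum, since $\mathbb A$ is finite. For $x>y$ in $\mathbb A$ put $$\left[{xy\atop ab}\right]=\binom{yx}{ba}+\binom{yx}{ab}-\binom{xy}{ba}\ \ (a>b),\qquad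 \left[{xy\atop aa}\right]=\binom{yx}{aa}\ \ (\text{all }a).$$ Ideal and quotient. $\mathcal I$ is the two-sided ideal of $\mathcal A$ generated by all elements $\binom{xy}{ab}-\left[{xy\atop ab}\right]$ with $x>y$, $a\ge b$, and $\mathcal R=\mathcal A/\mathcal I$ (the ''1-quantum right algebra''). Reduction. The reduction $E\mapsto [E]$ on $\mathbb Z\langle\mathcal B\rangle$ is the $\mathbb Z$-linear map onto the finite irreducible expressions determined by: $[E]=E$ if $E$ is irreducible; for $x>y$, $a\ge b$ the value on $\binom{xy}{ab}$ is $\left[{xy\atop ab}\right]$ above; and for a biword $\alpha\notin\mathcal B_{\rm irr}$ factorized as $\alpha=\beta\binom{xy}{ab}\gamma$ with $\beta,\gamma\in\mathcal B$, $x>y$, $a\ge b$, and $\beta\binom{x}{a}\in\mathcal B_{\rm irr}$ (so the first double descent is at $\binom{xy}{ab}$), $[\alpha]=\bigl[\beta\times\left[{xy\atop ab}\right]\times\gamma\bigr]$. (This recursion terminates and is well defined.) It is extended to $\mathcal A$ by $[E]=\sum_{n\ge0}[E^{(n)}]$. ''Basis'' is in the sense of formal sums: each element is uniquely a (possibly infinite) formal $\mathbb Z$-linear combination of elements of $\mathcal B_{\rm irr}$.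
   Formalization: The ideal I is taken to be the closure, under coefficientwise convergence of formal sums, of the two-sided ideal generated by the relations; with the purely algebraic ideal (finite sums) statement (1) is false for every r ≥ 2. *)

(* Defs.v *)
From HB Require Import structures.
From mathcomp Require Import all_boot all_order all_algebra.
From mathcomp Require Import generic_quotient ring_quotient.
From mathcomp Require Import boolp classical_sets functions cardinality fsbigop.
From mathcomp Require Import zify.

Set Implicit Arguments.
Unset Strict Implicit.
Unset Printing Implicit Defensive.

Import Order.TTheory GRing.Theory Num.Theory.
Local Open Scope ring_scope.
Local Open Scope quotient_scope.

(* The alphabet {1, ..., r} is encoded as 'I_r = {0, ..., r-1} with its order;
   the biletter with top x and bottom a is the pair (x, a). *)
Notation biletter r := ('I_r * 'I_r)%type.
Notation biword r := (seq (biletter r)).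

Definition ddescent (r : nat) (p q : biletter r) : bool :=
  (q.1 < p.1)%N && (q.2 <= p.2)%N.

Definition irreducible (r : nat) (w : biword r) : bool :=
  sorted (fun p q => ~~ ddescent p q) w.

(* E w is the coefficient of the biword w in the expression E.  The alias
   keeps the pointwise product of functions away from expr r. *)
Definition expr (r : nat) : Type := biword r -> int.
HB.instance Definition _ (r : nat) := GRing.Zmodule.copy (expr r) (biword r -> int).

Definition bw (r : nat) (w : biword r) : expr r := fun v => (v == w)%:Z.

Section ExprRing.
Variable r : nat.
Implicit Types (E F G : expr r) (w : biword r).

Lemma addE E F w : (E + F) w = E w + F w. Proof. by []. Qed.
Lemma oppE E w : (- E) w = - E w. Proof. by []. Qed.
Lemma zeroE w : (0 : expr r) w = 0. Proof. by []. Qed.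
Lemma subE E F w : (E - F) w = E w - F w. Proof. by []. Qed.

Lemma sumE (I : Type) (s : seq I) (P : pred I) (f : I -> expr r) w :
  (\sum_(i <- s | P i) f i) w = \sum_(i <- s | P i) f i w.
Proof. by apply: (big_morph (fun E : expr r => E w)). Qed.

Lemma mulrnE E n w : (E *+ n) w = E w *+ n.
Proof. by elim: n => // n IH; rewrite !mulrS addE IH. Qed.

Lemma mulrzE E (n : int) w : (E *~ n) w = n * E w.
Proof.
case: n => n; rewrite ?NegzE ?mulrNz ?oppE -pmulrn mulrnE -mulr_natl ?mulNr;
  by rewrite natz.
Qed.

(* Product induced by concatenation: sum over all factorizations of w. *)
Definition expr_mul E F : expr r :=
  fun w => \sum_(0 <= i < (size w).+1) E (take i w) * F (drop i w).

Lemma expr_mulA : associative expr_mul.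
Proof.
move=> E F G; apply/funext => w; rewrite /expr_mul.
set n := size w.
transitivity (\sum_(0 <= i < n.+1) \sum_(i <= j < n.+1)
   E (take i w) * (F (drop i (take j w)) * G (drop j w))).
  apply: eq_big_nat => i /andP[_ lei].
  rewrite big_distrr /= size_drop -[i in RHS]add0n [RHS]big_addn.
  have -> : (n.+1 - i = (n - i).+1)%N by lia.
  apply: eq_big_nat => j /andP[_ lej].
  by rewrite drop_drop take_drop.
transitivity (\sum_(0 <= j < n.+1) \sum_(0 <= i < n.+1 | (i <= j)%N)
   E (take i w) * (F (drop i (take j w)) * G (drop j w))).
  under eq_big_nat => i /andP[_ lei].
    rewrite (@big_nat_widenl _ _ _ i 0) //.
    over.
  by rewrite (exchange_big_dep_nat xpredT).
apply: eq_big_nat => j /andP[_ lej].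
rewrite big_distrl /= size_takel //.
rewrite [RHS](big_nat_widen _ _ n.+1) //.
apply: congr_big_nat => // i /andP[/= lei _].
by rewrite mulrA take_takel.
Qed.

Lemma expr_mul1l : left_id (bw [::]) expr_mul.
Proof.
move=> E; apply/funext => w; rewrite /expr_mul big_nat_recl // take0 drop0.
rewrite /bw eqxx mul1r big_nat big1 ?addr0 // => i /andP[_ lti].
by rewrite -size_eq0 size_takel //= mul0r.
Qed.

Lemma expr_mul1r : right_id (bw [::]) expr_mul.
Proof.
move=> E; apply/funext => w; rewrite /expr_mul big_nat_recr //=.
rewrite take_size drop_size /bw eqxx mulr1 big_nat big1 ?add0r // => i lti.
rewrite -size_eq0 size_drop; have -> : (size w - i == 0)%N = false by lia.
by rewrite mulr0.
Qed.

Lemma expr_mulDl : left_distributive expr_mul +%R.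
Proof.
move=> E F G; apply/funext => w; rewrite addE /expr_mul -big_split /=.
by apply: eq_bigr => i _; rewrite addE mulrDl.
Qed.

Lemma expr_mulDr : right_distributive expr_mul +%R.
Proof.
move=> E F G; apply/funext => w; rewrite addE /expr_mul -big_split /=.
by apply: eq_bigr => i _; rewrite addE mulrDr.
Qed.

Lemma bw1_neq0 : bw [::] != 0 :> expr r.
Proof. by apply/eqP => /(congr1 (fun E : expr r => E [::])). Qed.

End ExprRing.

HB.instance Definition _ (r : nat) := GRing.Zmodule_isNzRing.Build (expr r)
  (@expr_mulA r) (@expr_mul1l r) (@expr_mul1r r) (@expr_mulDl r)
  (@expr_mulDr r) (@bw1_neq0 r).

Lemma mulE (r : nat) (E F : expr r) w :
  (E * F) w = \sum_(0 <= i < (size w).+1) E (take i w) * F (drop i w).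
Proof. by []. Qed.

Lemma bw_mul (r : nat) (u v : biword r) : bw u * bw v = bw (u ++ v).
Proof.
apply/funext => w; rewrite mulE /bw.
have [->|neq] := eqVneq w (u ++ v).
  rewrite (bigD1_seq (size u)) ?mem_index_iota ?iota_uniq //=; last first.
    by rewrite size_cat; lia.
  rewrite take_size_cat // drop_size_cat // !eqxx big_nat_cond big1 ?addr0 //.
  move=> i /andP[/andP[_ lei] neqi].
  case: (eqVneq (take _ _) u) => [equ|]; last by rewrite mul0r.
  by case/eqP: neqi; rewrite -equ size_takel.
rewrite big1 // => i _.
case: (eqVneq (take _ _) u) => [equ|]; last by rewrite mul0r.
case: (eqVneq (drop _ _) v) => [eqv|]; last by rewrite mulr0.
by move: neq; rewrite -equ -eqv cat_take_drop eqxx.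
Qed.

(* Formal sum of a family of expressions, computed coefficient by coefficient;
   meaningful when each biword has a nonzero coefficient in finitely many F i. *)
Definition expr_sum (r : nat) (I : choiceType) (F : I -> expr r) : expr r :=
  fun w => \sum_(i \in [set: I]) F i w.

Definition homog (r : nat) (n : nat) (E : expr r) : expr r :=
  fun w => if size w == n then E w else 0.

(* For p = (x, a), q = (y, b) this is the bracket [xy / ab]. *)
Definition bracket (r : nat) (p q : biletter r) : expr r :=
  let: (x, a) := p in let: (y, b) := q in
  if a == b then bw [:: (y, b); (x, a)]
  else bw [:: (y, b); (x, a)] + bw [:: (y, a); (x, b)] - bw [:: (x, b); (y, a)].

(* Splits w as (beta, p, q, gamma) at its first double descent (p, q). *)
Fixpoint first_dd (r : nat) (w : biword r) :
    option (biword r * biletter r * biletter r * biword r) :=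
  if w is p :: w' then
    if w' is q :: g then
      if ddescent p q then Some ([::], p, q, g)
      else omap (fun d => let: (b, p', q', g') := d in (p :: b, p', q', g'))
                (first_dd w')
    else None
  else None.

(* The recursion is run with fuel k; the weight of a biword, its rank in the
   lexicographic order, strictly decreases at each step, so that it is always
   enough fuel: redw below satisfies the intended recursion (lemma redw_step). *)
Fixpoint redw_fuel (r : nat) (k : nat) (w : biword r) : expr r :=
  match first_dd w, k with
  | None, _ => bw w
  | Some _, 0 => 0
  | Some (b, (x, a), (y, c), g), k'.+1 =>
      if a == c then redw_fuel k' (b ++ [:: (y, c), (x, a) & g])
      else redw_fuel k' (b ++ [:: (y, c), (x, a) & g])
         + redw_fuel k' (b ++ [:: (y, a), (x, c) & g])
         - redw_fuel k' (b ++ [:: (x, c), (y, a) & g])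
  end.

Definition weight (r : nat) (w : biword r) : nat :=
  foldl (fun m (p : biletter r) => m * (r * r) + (p.1 * r + p.2))%N 0 w.

Definition redw (r : nat) (w : biword r) : expr r := redw_fuel (weight w) w.

(* [E] is the sum over n of the reductions of the homogeneous components of E,
   each of which is a finite linear combination of biwords.  Lemmas
   reduction_id and reduction_step give its defining equations. *)
Definition reduction (r : nat) (E : expr r) : expr r :=
  expr_sum (fun n : nat =>
    \sum_(t : n.-tuple (biletter r)) redw t *~ homog n E t).

Section Reduction.
Variable r : nat.
Implicit Types (E F : expr r) (w b g : biword r) (p q : biletter r).

Lemma first_ddP w :
  match first_dd w with
  | None => irreducible w
  | Some (b, p, q, g) =>
      [/\ w = b ++ [:: p, q & g], ddescent p q & irreducible (rcons b p)]
  end.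
Proof.
elim: w => // p [|q g] // IH; rewrite [first_dd _]/=.
case: ifPn => [d //|ndd]; rewrite -/(first_dd (q :: g)).
case: (first_dd (q :: g)) IH => [[[[b p'] q'] g']|]; last first.
  by rewrite /irreducible /= => ->; rewrite ndd.
case=> e d i; split; [by rewrite e | by [] |].
case: b e i => [|p0 b] [e1 e2] i; subst; first by rewrite /irreducible /= ndd.
by move: i; rewrite /irreducible /= ndd.
Qed.

Lemma irr_first_dd w : irreducible w -> first_dd w = None.
Proof.
have := first_ddP w; case: (first_dd w) => // [[[[b p] q] g]] [-> d _].
rewrite /irreducible; case: b => [|p0 b] /=; first by rewrite d.
by rewrite cat_path /= d !andbF.
Qed.

Lemma first_dd_cat b p q g : ddescent p q -> irreducible (rcons b p) ->
  first_dd (b ++ [:: p, q & g]) = Some (b, p, q, g).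
Proof.
move=> d; elim: b => [|p0 b IH] /= i; first by rewrite d.
have ib : irreducible (rcons b p) by apply: path_sorted i.
rewrite IH //=; case: b i {IH ib} => [|p1 b] /= /andP[/negbTE-> _] //.
Qed.

Let wt (m : nat) w : nat :=
  foldl (fun m (p : biletter r) => m * (r * r) + (p.1 * r + p.2))%N m w.

Let wt_shift m w : wt m w = (m * (r * r) ^ size w + wt 0 w)%N.
Proof.
elim: w m => [|p w IH] m; rewrite /wt /=; first by rewrite muln1 addn0.
by rewrite -!/(wt _ _) [LHS]IH [in RHS]IH mul0n add0n expnS; nia.
Qed.

Let wt_lt m n w : (m < n)%N -> (wt m w < wt n w)%N.
Proof.
move=> ltmn; rewrite [X in (X < _)%N]wt_shift [X in (_ < X)%N]wt_shift ltn_add2r.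
case: w => [|[[x ltx] a] w]; first by rewrite !muln1.
by rewrite ltn_pmul2r // expn_gt0 muln_gt0 (leq_trans _ ltx).
Qed.

Lemma weight_cat_lt b g p q p' q' :
  (weight [:: p; q] < weight [:: p'; q'] ->
  weight (b ++ [:: p, q & g]) < weight (b ++ [:: p', q' & g]))%N.
Proof.
have wt_cat m u v : wt m (u ++ v) = wt (wt m u) v by rewrite /wt foldl_cat.
rewrite -[weight [:: p; q]]/(wt 0 [:: p; q]).
rewrite -[weight [:: p'; q']]/(wt 0 [:: p'; q']) => lt.
rewrite -[weight (b ++ [:: p, q & g])]/(wt 0 (b ++ [:: p; q] ++ g)).
rewrite -[weight (b ++ [:: p', q' & g])]/(wt 0 (b ++ [:: p'; q'] ++ g)).
rewrite !wt_cat; apply: wt_lt.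
by rewrite [X in (X < _)%N]wt_shift [X in (_ < X)%N]wt_shift ltn_add2l.
Qed.

Lemma bracket_weight (x a y c : 'I_r) : ddescent (x, a) (y, c) ->
  [/\ (weight [:: (y, c); (x, a)] < weight [:: (x, a); (y, c)])%N,
      (weight [:: (y, a); (x, c)] < weight [:: (x, a); (y, c)])%N
    & (a != c -> weight [:: (x, c); (y, a)] < weight [:: (x, a); (y, c)])%N].
Proof.
case: x y a c => x ltx [y lty] [a lta] [c ltc].
rewrite /ddescent /weight -val_eqE /= => /andP[ltyx leca].
have xr : (y * r + r <= x * r)%N by nia.
have small u v : (u < r -> v < r -> u * r + v < r * r)%N by move=> *; nia.
have key u v m n : (u < v -> m < r * r -> u * (r * r) + m < v * (r * r) + n)%N.
  by move=> *; nia.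
split; rewrite ?mul0n ?add0n.
- by apply: key; [lia | apply: small].
- by apply: key; [lia | apply: small].
- by move=> neq; apply: key; [lia | apply: small].
Qed.

Lemma redw_fuel_enough k l w :
  (weight w <= k)%N -> (weight w <= l)%N -> redw_fuel k w = redw_fuel l w.
Proof.
elim: k l w => [|k IH] l w lek lel; rewrite [LHS]/= [RHS]/=.
  have := first_ddP w; case: l lel => [|l] lel //=.
  case: (first_dd w) => // [[[[b [x a]] [y c]] g]] [e d _].
  have [lt _ _] := bracket_weight d; subst w.
  by have := weight_cat_lt b g lt; lia.
have := first_ddP w; case: l lel => [|l] lel /=;
  case: (first_dd w) => // [[[[b [x a]] [y c]] g]] [e d _];
  have [lt1 lt2 lt3] := bracket_weight d; subst w;
  have := weight_cat_lt b g lt1;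
  have := weight_cat_lt b g lt2; first by lia.
move=> l2 l1; case: eqVneq => [_|neq]; first by apply: IH; lia.
have l3 := weight_cat_lt b g (lt3 neq).
by congr (_ + _ - _); apply: IH; lia.
Qed.

Lemma redw_irr w : irreducible w -> redw w = bw w.
Proof. by rewrite /redw => /irr_first_dd; case: weight => [|k] /= ->. Qed.

Lemma redw_step b g (x a y c : 'I_r) :
  ddescent (x, a) (y, c) -> irreducible (rcons b (x, a)) ->
  redw (b ++ [:: (x, a), (y, c) & g]) =
    if a == c then redw (b ++ [:: (y, c), (x, a) & g])
    else redw (b ++ [:: (y, c), (x, a) & g])
       + redw (b ++ [:: (y, a), (x, c) & g])
       - redw (b ++ [:: (x, c), (y, a) & g]).
Proof.
move=> d i; rewrite {1}/redw.
have [lt1 lt2 lt3] := bracket_weight d.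
have l1 := weight_cat_lt b g lt1.
have l2 := weight_cat_lt b g lt2.
case E : (weight (b ++ [:: (x, a), (y, c) & g])) => [|k]; first by lia.
rewrite [LHS]/= first_dd_cat //.
case: eqVneq => [_|neq]; first by apply: redw_fuel_enough; lia.
have l3 := weight_cat_lt b g (lt3 neq).
by congr (_ + _ - _); apply: redw_fuel_enough; lia.
Qed.

(* Induction along the recursion defining redw. *)
Lemma redw_ind (P : biword r -> expr r -> Prop) :
  (forall w, irreducible w -> P w (bw w)) ->
  (forall b g (x a y : 'I_r),
     P (b ++ [:: (y, a), (x, a) & g]) (redw (b ++ [:: (y, a), (x, a) & g])) ->
     P (b ++ [:: (x, a), (y, a) & g]) (redw (b ++ [:: (y, a), (x, a) & g]))) ->
  (forall b g (x a y c : 'I_r) E1 E2 E3,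
     P (b ++ [:: (y, c), (x, a) & g]) E1 ->
     P (b ++ [:: (y, a), (x, c) & g]) E2 ->
     P (b ++ [:: (x, c), (y, a) & g]) E3 ->
     P (b ++ [:: (x, a), (y, c) & g]) (E1 + E2 - E3)) ->
  forall w, P w (redw w).
Proof.
move=> Pirr Peq Pneq w; have [n] := ubnP (weight w).
elim: n w => // n IH w; have := first_ddP w.
case: (first_dd w) => [[[[b [x a]] [y c]] g]|i _]; last by rewrite redw_irr //; apply: Pirr.
move=> [e d i] lew; rewrite e redw_step //; subst w.
have [lt1 lt2 lt3] := bracket_weight d.
have l1 := weight_cat_lt b g lt1.
have l2 := weight_cat_lt b g lt2.
case: eqVneq => [e|neq].
  by subst c; apply: Peq; apply: IH; lia.
have l3 := weight_cat_lt b g (lt3 neq).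
by apply: Pneq; apply: IH; lia.
Qed.

Lemma redw_size w v : size v != size w -> redw w v = 0.
Proof.
apply: (redw_ind (P := fun w E => size v != size w -> E v = 0)).
- by move=> {}w _; rewrite /bw; have [->|//] := eqVneq v w; rewrite eqxx.
- by move=> b g x a y; rewrite !size_cat /=.
- move=> b g x a y c E1 E2 E3; rewrite !size_cat /= => h1 h2 h3 h.
  by rewrite subE addE h1 // h2 // h3.
Qed.

Lemma redw_irr_support w v : ~~ irreducible v -> redw w v = 0.
Proof.
move=> nv; apply: (redw_ind (P := fun w E => E v = 0)) => //.
- by move=> {}w i; rewrite /bw; case: eqVneq => // e; rewrite e i in nv.
- by move=> b g x a y c E1 E2 E3 h1 h2 h3; rewrite subE addE h1 h2 h3.
Qed.

Lemma reductionE E w :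
  reduction E w = \sum_(t : (size w).-tuple (biletter r)) E t * redw t w.
Proof.
rewrite /reduction /expr_sum (fsbigE [:: size w]) // => [|n _]; last first.
  rewrite inE => neq; rewrite sumE big1 // => t _.
  by rewrite mulrzE redw_size ?mulr0 // size_tuple eq_sym.
rewrite big_cons big_nil in_setT /= addr0 sumE; apply: eq_bigr => t _.
by rewrite mulrzE /homog size_tuple eqxx.
Qed.

Lemma reductionB E F : reduction (E - F) = reduction E - reduction F.
Proof.
apply/funext => w; rewrite subE !reductionE -sumrB.
by apply: eq_bigr => t _; rewrite subE mulrBl.
Qed.

Lemma reduction_bw w : reduction (bw w) = redw w.
Proof.
apply/funext => v; rewrite reductionE /bw.
have [eqs|neq] := eqVneq (size w) (size v); last first.
  rewrite redw_size 1?eq_sym // big1 // => t _.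
  case: eqVneq => [e|_]; last by rewrite mul0r.
  by rewrite -e size_tuple eqxx in neq.
have sw : size w == size v by apply/eqP.
rewrite (bigD1 (Tuple sw)) //= eqxx mul1r big1 ?addr0 // => t neq.
case: eqVneq => [e|_]; last by rewrite mul0r.
by case/eqP: neq; apply: val_inj.
Qed.

Lemma reduction_step b g p q :
  ddescent p q -> irreducible (rcons b p) ->
  reduction (bw b * bw [:: p; q] * bw g) = reduction (bw b * bracket p q * bw g).
Proof.
case: p q => [x a] [y c] d i.
rewrite !bw_mul reduction_bw -catA redw_step //=; case: eqVneq => _.
  by rewrite !bw_mul reduction_bw -catA.
have red0 : reduction (0 : expr r) = 0.
  by rewrite -[0 in LHS](subrr (0 : expr r)) reductionB subrr.
have redD E F : reduction (E + F) = reduction E + reduction F.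
  by rewrite -[F in LHS]opprK -[- F]sub0r !reductionB red0 sub0r opprK.
rewrite mulrBr mulrDr mulrBl mulrDl !bw_mul reductionB redD !reduction_bw.
by rewrite -!catA.
Qed.

End Reduction.

Definition irr_expr (r : nat) : {pred expr r} :=
  fun E => `[< forall w, ~~ irreducible w -> E w = 0 >].
Arguments irr_expr : clear implicits.

Lemma irr_exprP (r : nat) (E : expr r) :
  reflect (forall w, ~~ irreducible w -> E w = 0) (E \in irr_expr r).
Proof. exact: asboolP. Qed.

Lemma irr_expr_zmod_closed (r : nat) : zmod_closed (irr_expr r).
Proof.
split=> [|E F /irr_exprP hE /irr_exprP hF]; apply/irr_exprP => // w iw.
by rewrite subE hE // hF // subr0.
Qed.
HB.instance Definition _ (r : nat) :=
  GRing.isZmodClosed.Build (expr r) (irr_expr r) (@irr_expr_zmod_closed r).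

Record Airr (r : nat) : Type :=
  MkAirr { Airr_val :> expr r; AirrP : Airr_val \in irr_expr r }.
HB.instance Definition _ (r : nat) := [isSub for @Airr_val r].
HB.instance Definition _ (r : nat) := [Choice of Airr r by <:].
HB.instance Definition _ (r : nat) := [SubChoice_isSubZmodule of Airr r by <:].

Definition Birr (r : nat) := {w : biword r | irreducible w}.
HB.instance Definition _ (r : nat) := Choice.on (Birr r).

Lemma reduction_irr (r : nat) (E : expr r) : reduction E \in irr_expr r.
Proof.
apply/irr_exprP => w nw; rewrite reductionE big1 // => t _.
by rewrite redw_irr_support // mulr0.
Qed.

Lemma reduction_id (r : nat) (E : expr r) : E \in irr_expr r -> reduction E = E.
Proof.
move=> /irr_exprP hE; apply/funext => w; rewrite reductionE.
rewrite (bigD1 (in_tuple w)) //= big1 ?addr0 => [|t neq].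
  case: (boolP (irreducible w)) => i; last by rewrite hE // mul0r.
  by rewrite redw_irr // /bw eqxx mulr1.
case: (boolP (irreducible t)) => i; last by rewrite hE // mul0r.
rewrite redw_irr // /bw; case: eqVneq => [e|]; last by rewrite mulr0.
by case/eqP: neq; apply: val_inj.
Qed.

Definition Airr_mul (r : nat) (E F : Airr r) : Airr r :=
  MkAirr (reduction_irr ((E : expr r) * (F : expr r))).

Section Ideal.
Local Open Scope classical_set_scope.

Definition relations (r : nat) : set (expr r) :=
  [set E | exists p q, ddescent p q /\ E = bw [:: p; q] - bracket p q].

Definition two_sided_ideal (r : nat) (J : set (expr r)) : Prop :=
  [/\ J 0, forall E F, J E -> J F -> J (E - F)
    & forall E F G, J F -> J (E * F * G)].

(* Closure for the topology of coefficientwise convergence of formal sums. *)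
Definition formal_closure (r : nat) (J : set (expr r)) : set (expr r) :=
  [set E | forall n, exists2 F, J F & forall w, (size w <= n)%N -> E w = F w].

(* The ideal is closed under formal sums, like the algebra itself.  The purely
   algebraic ideal of finite sums of E * g * F, g a relation, is too small: for
   u = (1,1), v = (2,1) and the relation g = vu - uv, it does not contain the
   sum over n of u^n g v^n, although this expression reduces to 0. *)
Definition rel_ideal (r : nat) : {pred expr r} :=
  fun E => `[< formal_closure (smallest (@two_sided_ideal r) (@relations r)) E >].
Arguments rel_ideal : clear implicits.

Lemma smallest_two_sided_ideal (r : nat) (G : set (expr r)) :
  two_sided_ideal (smallest (@two_sided_ideal r) G).
Proof.
split=> [J [[]//]|E F hE hF J hJ|E F G' hF J hJ]; have [[_ hB hM] _] := hJ.
  by apply: hB; [apply: hE | apply: hF].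
by apply: hM; apply: hF.
Qed.

Lemma formal_closure_ideal (r : nat) (J : set (expr r)) :
  two_sided_ideal J -> two_sided_ideal (formal_closure J).
Proof.
move=> [h0 hB hM]; split=> [n|E F hE hF n|E F G hF n]; first by exists 0.
  have [E' JE eE] := hE n; have [F' JF eF] := hF n.
  by exists (E' - F'); [exact: hB | move=> w lew; rewrite !subE eE ?eF].
have [F' JF eF] := hF n; exists (E * F' * G); first exact: hM.
move=> w lew; rewrite !mulE; apply: eq_big_nat => i lei; congr (_ * _).
rewrite !mulE; apply: eq_big_nat => j lej; rewrite eF //.
by rewrite size_drop; move: (size_take_min i w); lia.
Qed.

Lemma rel_idealP (r : nat) : two_sided_ideal [set E | E \in rel_ideal r].
Proof.
have [h0 hB hM] := formal_closure_ideal (smallest_two_sided_ideal (@relations r)).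
split=> /= [|E F /asboolP hE /asboolP hF|E F G /asboolP hF]; apply/asboolP => //.
- exact: hB.
- exact: hM.
Qed.

End Ideal.
Arguments rel_ideal : clear implicits.

Lemma rel_ideal_zmod_closed (r : nat) : zmod_closed (rel_ideal r).
Proof. by have [h0 hB _] := rel_idealP r. Qed.
HB.instance Definition _ (r : nat) :=
  GRing.isZmodClosed.Build (expr r) (rel_ideal r) (@rel_ideal_zmod_closed r).

(* The quotient algebra R; the library only provides the ring structure on
   quotients of commutative rings. *)
Definition qalg (r : nat) := Quotient.quot (rel_ideal r).
HB.instance Definition _ (r : nat) := GRing.Zmodule.on (qalg r).

Section QuotientRing.
Variable r : nat.

Definition to_qalg (E : expr r) : qalg r := \pi_(Quotient.quot (rel_ideal r)) E.

Lemma to_qalgP (E F : expr r) :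
  reflect (to_qalg E = to_qalg F) (E - F \in rel_ideal r).
Proof. by rewrite Quotient.idealrBE; apply: eqP. Qed.

Lemma to_qalg_surj (C : qalg r) : to_qalg (repr C) = C.
Proof. exact: reprK. Qed.

Definition qalg_mul (C D : qalg r) : qalg r :=
  to_qalg (repr C * repr D).

Lemma to_qalgM (E F : expr r) : to_qalg (E * F) = qalg_mul (to_qalg E) (to_qalg F).
Proof.
have [_ _ hM] := rel_idealP r.
have /to_qalgP hE : to_qalg E = to_qalg (repr (to_qalg E)) by rewrite to_qalg_surj.
have /to_qalgP hF : to_qalg F = to_qalg (repr (to_qalg F)) by rewrite to_qalg_surj.
apply/to_qalgP; set E' := repr (to_qalg E) in hE *; set F' := repr _ in hF *.
have -> : E * F - E' * F' = (E - E') * F + E' * (F - F').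
  by rewrite mulrBl mulrBr addrA subrK.
apply: rpredD; first by have := hM 1 _ F hE; rewrite /= mul1r.
by have := hM E' _ 1 hF; rewrite /= mulr1.
Qed.

Lemma to_qalgD (E F : expr r) : to_qalg (E + F) = to_qalg E + to_qalg F.
Proof. exact: (raddfD (\pi_(Quotient.quot (rel_ideal r)))). Qed.

Lemma qalg_mulA : associative qalg_mul.
Proof.
move=> C D E; rewrite -[C]to_qalg_surj -[D]to_qalg_surj -[E]to_qalg_surj.
by rewrite -!to_qalgM mulrA.
Qed.
Lemma qalg_mul1l : left_id (to_qalg 1) qalg_mul.
Proof. by move=> C; rewrite -[C]to_qalg_surj -to_qalgM mul1r. Qed.
Lemma qalg_mul1r : right_id (to_qalg 1) qalg_mul.
Proof. by move=> C; rewrite -[C]to_qalg_surj -to_qalgM mulr1. Qed.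
Lemma qalg_mulDl : left_distributive qalg_mul +%R.
Proof.
move=> C D E; rewrite -[C]to_qalg_surj -[D]to_qalg_surj -[E]to_qalg_surj.
by rewrite -to_qalgD -!to_qalgM -to_qalgD mulrDl.
Qed.
Lemma qalg_mulDr : right_distributive qalg_mul +%R.
Proof.
move=> C D E; rewrite -[C]to_qalg_surj -[D]to_qalg_surj -[E]to_qalg_surj.
by rewrite -to_qalgD -!to_qalgM -to_qalgD mulrDr.
Qed.

End QuotientRing.

HB.instance Definition _ (r : nat) := GRing.Zmodule_isPzRing.Build (qalg r)
  (@qalg_mulA r) (@qalg_mul1l r) (@qalg_mul1r r) (@qalg_mulDl r) (@qalg_mulDr r).

Lemma to_qalg_zmod (r : nat) : zmod_morphism (@to_qalg r).
Proof. exact: (raddfB (\pi_(Quotient.quot (rel_ideal r)))). Qed.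
HB.instance Definition _ (r : nat) :=
  GRing.isZmodMorphism.Build (expr r) (qalg r) (@to_qalg r) (@to_qalg_zmod r).
Lemma to_qalg_monoid (r : nat) : monoid_morphism (@to_qalg r).
Proof. by split=> // E F; rewrite to_qalgM. Qed.
HB.instance Definition _ (r : nat) :=
  GRing.isMonoidMorphism.Build (expr r) (qalg r) (@to_qalg r) (@to_qalg_monoid r).

Definition Airr_to_qalg (r : nat) (E : Airr r) : qalg r := to_qalg (E : expr r).

Definition Birr_sum (r : nat) (c : Birr r -> int) : expr r :=
  expr_sum (fun a : Birr r => bw (val a) *~ c a).

Lemma Birr_sumE (r : nat) (c : Birr r -> int) (a : Birr r) :
  Birr_sum c (val a) = c a.
Proof.
rewrite /Birr_sum /expr_sum (fsbigE [:: a]) // => [|b _]; last first.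
  by rewrite inE mulrzE /bw (inj_eq val_inj) eq_sym => /negbTE->; rewrite mulr0.
by rewrite big_cons big_nil in_setT /= addr0 mulrzE /bw eqxx mulr1.
Qed.

Lemma Birr_sum_irr (r : nat) (c : Birr r -> int) : Birr_sum c \in irr_expr r.
Proof.
apply/irr_exprP => w nw; rewrite /Birr_sum /expr_sum fsbig1 // => a _.
rewrite mulrzE /bw; case: eqVneq => [e|]; last by rewrite mulr0.
by rewrite e (valP a) in nw.
Qed.

(* Main.v *)
(* This is Bergman's diamond lemma.  Rewriting at any double descent, not only
   the first, does not change the reduction: by induction on the weight, two
   rewritings at disjoint places commute, and two overlapping ones involve
   x > y > z over a >= b >= c, where both results have the same normal form.
   So the reduction vanishes on every X (u - [u]) Y with u a double descent, and
   by continuity on the closed ideal; conversely E - [E] lies in the ideal,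
   since at each length it is a finite sum of rewriting steps. *)
Require Import Defs.
From HB Require Import structures.
From mathcomp Require Import all_boot all_order all_algebra.
From mathcomp Require Import boolp classical_sets.
From mathcomp Require Import zify.
Import GRing.Theory.
Local Open Scope ring_scope.

Set Implicit Arguments.
Unset Strict Implicit.
Unset Printing Implicit Defensive.

(** * Brackets and overlapping double descents *)

(* The linear extension of a function of two biletters, evaluated at [bracket]. *)
Definition lin_bracket (r : nat) (f : biletter r -> biletter r -> int)
    (p q : biletter r) : int :=
  if p.2 == q.2 then f q p
  else f q p + f (q.1, p.2) (p.1, q.2) - f (p.1, q.2) (q.1, p.2).

(** The strict lexicographic order on pairs of biletters. Weak inequalities stand in place of
    equalities so that rewriting with known inequalities decides it. *)
Definition lex2 (r : nat) (p' q' p q : biletter r) : bool :=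
  ((p'.1 < p.1) || (p'.1 <= p.1) && ((p'.2 < p.2) || (p'.2 <= p.2) &&
  ((q'.1 < q.1) || (q'.1 <= q.1) && (q'.2 < q.2))))%N.

(** A rule fires only where [facts] proves its side conditions; the loop stops when no rule does. *)
Ltac normalize_words f f12 f12e f23 f23e low facts :=
  repeat match goal with |- context [f (?x1, ?a1) (?x2, ?a2) (?x3, ?a3)] =>
    first [ rewrite (f12e x1 a1 x2 x3 a3); [|by rewrite /low /lex2 /= ?facts ..]
          | rewrite (f12 x1 a1 x2 a2 x3 a3); [|by rewrite /low /lex2 /= ?facts ..]
          | rewrite (f23e x1 a1 x2 a2 x3); [|by rewrite /low /lex2 /= ?facts ..]
          | rewrite (f23 x1 a1 x2 a2 x3 a3);
              [|by rewrite /low /lex2 /= ?facts ..] ]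
  end.

(* The rewriting rules are assumed only below (p, q): the diamond lemma has them
   there by induction. *)
Lemma overlap_resolvable (r : nat)
    (f : biletter r -> biletter r -> biletter r -> int) (p q s : biletter r) :
  ddescent p q -> ddescent q s ->
  (forall p' q' s', lex2 p' q' p q -> ddescent p' q' ->
     f p' q' s' = lin_bracket (fun u v => f u v s') p' q') ->
  (forall p' q' s', lex2 p' q' p q -> ddescent q' s' ->
     f p' q' s' = lin_bracket (f p') q' s') ->
  lin_bracket (fun u v => f u v s) p q = lin_bracket (f p) q s.
Proof.
case: p q s => x a [y b] [z c].
rewrite /ddescent /= => /andP[yx ba] /andP[zy cb] H12 H23.
pose low x1 a1 x2 a2 := lex2 (x1, a1) (x2, a2) (x, a) (y, b).
(* Each rule is split by whether the bottom letters are equal or strictly decreasing, which settles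
   the test in [lin_bracket]. *)
have f12 (x1 a1 x2 a2 x3 a3 : 'I_r) : low x1 a1 x2 a2 -> (x2 < x1)%N -> (a2 < a1)%N ->
    f (x1, a1) (x2, a2) (x3, a3) = f (x2, a2) (x1, a1) (x3, a3)
      + f (x2, a1) (x1, a2) (x3, a3) - f (x1, a2) (x2, a1) (x3, a3).
  move=> l lx la; have -> := H12 (x1, a1) (x2, a2) (x3, a3) l.
    by rewrite /lin_bracket /=; case: eqVneq la => // ->; rewrite ltnn.
  by rewrite /= lx ltnW.
have f12e (x1 a1 x2 x3 a3 : 'I_r) : low x1 a1 x2 a1 -> (x2 < x1)%N ->
    f (x1, a1) (x2, a1) (x3, a3) = f (x2, a1) (x1, a1) (x3, a3).
  move=> l lx; have -> := H12 (x1, a1) (x2, a1) (x3, a3) l.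
    by rewrite /lin_bracket /= eqxx.
  by rewrite /= lx leqnn.
have f23 (x1 a1 x2 a2 x3 a3 : 'I_r) : low x1 a1 x2 a2 -> (x3 < x2)%N -> (a3 < a2)%N ->
    f (x1, a1) (x2, a2) (x3, a3) = f (x1, a1) (x3, a3) (x2, a2)
      + f (x1, a1) (x3, a2) (x2, a3) - f (x1, a1) (x2, a3) (x3, a2).
  move=> l lx la; have -> := H23 (x1, a1) (x2, a2) (x3, a3) l.
    by rewrite /lin_bracket /=; case: eqVneq la => // ->; rewrite ltnn.
  by rewrite /= lx ltnW.
have f23e (x1 a1 x2 a2 x3 : 'I_r) : low x1 a1 x2 a2 -> (x3 < x2)%N ->
    f (x1, a1) (x2, a2) (x3, a2) = f (x1, a1) (x3, a2) (x2, a2).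
  move=> l lx; have -> := H23 (x1, a1) (x2, a2) (x3, a2) l.
    by rewrite /lin_bracket /= eqxx.
  by rewrite /= lx leqnn.
clear H12 H23.
have zx : (z < x)%N by apply: ltn_trans zy yx.
have facts := (yx, zy, zx, ltnn, leqnn, ltnW yx, ltnW zy, ltnW zx, orbT).
(* The cases are a = b = c, a = b > c, a > b = c and a > b > c. In each, normalizing leaves an
   integer identity linear in the values of [f]. *)
rewrite /lin_bracket /=; case: eqVneq => [eab|ab]; case: eqVneq => [ebc|bc].
- rewrite -{c cb}ebc -{b ba}eab in low f12 f12e f23 f23e *.
  by normalize_words f f12 f12e f23 f23e low facts.
- rewrite -{b ba}eab in low f12 f12e f23 f23e cb bc *.
  have ca : (c < a)%N by rewrite ltn_neqAle eq_sym bc.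
  have facts1 := (facts, ca, ltnW ca).
  normalize_words f f12 f12e f23 f23e low facts1; lia.
- rewrite -{c cb}ebc in low f12 f12e f23 f23e *.
  have {ab}ba : (b < a)%N by rewrite ltn_neqAle eq_sym ab.
  have facts1 := (facts, ba, ltnW ba).
  normalize_words f f12 f12e f23 f23e low facts1; lia.
- have {ab}ba : (b < a)%N by rewrite ltn_neqAle eq_sym ab.
  have {bc}cb : (c < b)%N by rewrite ltn_neqAle eq_sym bc.
  have ca : (c < a)%N by apply: ltn_trans cb ba.
  have facts1 := (facts, ba, cb, ca, ltnW ba, ltnW cb, ltnW ca).
  normalize_words f f12 f12e f23 f23e low facts1; lia.
Qed.

(** * The weight as a numeral in base r * r *)

Lemma weight_cat (r : nat) (u v : biword r) :
  weight (u ++ v) = (weight u * (r * r) ^ size v + weight v)%N.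
Proof.
elim/last_ind: v => [|v p IH]; first by rewrite cats0 muln1 addn0.
rewrite -rcons_cat /weight !foldl_rcons -!/(weight _) IH size_rcons expnSr.
by rewrite (mulnA (weight u)) mulnDl -addnA.
Qed.

Lemma weight_lt (r : nat) (w : biword r) : (weight w < (r * r) ^ size w)%N.
Proof.
elim/last_ind: w => [|w [x a] IH] //.
rewrite /weight foldl_rcons -/(weight _) size_rcons expnSr /=.
have := ltn_ord x; have := ltn_ord a; nia.
Qed.

(** The pair lowers the numeral by at least [(r * r) ^ size g], more than any tail of that length
    can restore. The tail may change because the third letter of an overlap varies. *)
Lemma weight_lex2 (r : nat) (b g g' : biword r) (p q p' q' : biletter r) :
  lex2 p' q' p q -> size g' = size g ->
  (weight (b ++ [:: p', q' & g']) < weight (b ++ [:: p, q & g]))%N.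
Proof.
move=> l eqs; rewrite -[[:: p', q' & g']]/([:: p'; q'] ++ g').
rewrite -[[:: p, q & g]]/([:: p; q] ++ g).
rewrite weight_cat [X in (_ < X)%N]weight_cat !size_cat eqs ltn_add2l.
rewrite weight_cat [X in (_ < X)%N]weight_cat eqs.
have lt : (weight [:: p'; q'] < weight [:: p; q])%N.
  case: p q p' q' l => x a [y c] [x' a'] [y' c'].
  rewrite /lex2 /weight /= !mul0n !add0n => l.
  have bnd (i j : 'I_r) : (i * r + j < r * r)%N.
    by have := ltn_ord i; have := ltn_ord j; nia.
  have step (i j i' j' : 'I_r) :
      ((i' < i) || (i' <= i) && (j' < j) -> i' * r + j' < i * r + j)%N.
    by have := ltn_ord j'; nia.
  have wstep (i j i' j' : 'I_r) :
      ((i' < i) || (i' <= i) && (j' <= j) -> i' * r + j' <= i * r + j)%N.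
    by have := ltn_ord j'; nia.
  have [lt|ge] := ltnP (x' * r + a') (x * r + a).
    by have := bnd y' c'; nia.
  have le : (x' * r + a' <= x * r + a)%N by apply: wstep; lia.
  have -> : (x' * r + a' = x * r + a)%N by lia.
  have nlt : ~~ ((x' < x) || (x' <= x) && (a' < a))%N.
    by apply/negP => /step; lia.
  by rewrite ltn_add2l; apply: step; lia.
have := weight_lt g'; rewrite eqs; nia.
Qed.

(** * Rewriting at an arbitrary double descent *)

(** Two pairs of the bracket start with a smaller top; the third, present only for distinct bottoms,
    keeps the top and has a smaller bottom. *)
Lemma eq_lin_bracket (r : nat) (f h : biletter r -> biletter r -> int)
    (p q : biletter r) : ddescent p q ->
  (forall p' q', lex2 p' q' p q -> f p' q' = h p' q') ->
  lin_bracket f p q = lin_bracket h p q.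
Proof.
case: p q => x a [y c] /andP[/= lyx lca] fh; rewrite /lin_bracket /=.
case: eqVneq => [_|ac]; rewrite !fh // /lex2 /= ?lyx //.
have ltca : (c < a)%N by rewrite ltn_neqAle eq_sym ac.
by rewrite ltca leqnn orbT.
Qed.

(** This is the commutation of rewritings at disjoint places. *)
Lemma lin_bracket_exchange (r : nat)
    (f : biletter r -> biletter r -> biletter r -> biletter r -> int)
    (p q p' q' : biletter r) :
  lin_bracket (fun u v => lin_bracket (f u v) p' q') p q =
  lin_bracket (fun u' v' => lin_bracket (fun u v => f u v u' v') p q) p' q'.
Proof. by rewrite /lin_bracket; case: eqP; case: eqP => // _ _; lia. Qed.

Lemma redw_first (r : nat) (b g v : biword r) (p q : biletter r) :
  ddescent p q -> irreducible (rcons b p) ->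
  redw (b ++ [:: p, q & g]) v =
  lin_bracket (fun s t => redw (b ++ [:: s, t & g]) v) p q.
Proof.
case: p q => x a [y c] d i; rewrite redw_step // /lin_bracket /=.
by case: eqVneq.
Qed.

Lemma redw_bracket (r : nat) (b g v : biword r) (p q : biletter r) :
  ddescent p q ->
  redw (b ++ [:: p, q & g]) v =
  lin_bracket (fun s t => redw (b ++ [:: s, t & g]) v) p q.
Proof.
have [n] := ubnP (weight (b ++ [:: p, q & g])).
elim: n b g p q => // n IH b g p q; rewrite ltnS => len d.
(* A double descent of [rcons b p] precedes [(p, q)], possibly sharing [p] with it; if there is
   none, [(p, q)] is the first of the word. *)
have := first_ddP (rcons b p).
case: (first_dd _) => [[[[b1 p1] q1] g1]|]; last exact: redw_first.
have low b2 p2 q2 g2 p' q' g' : b2 ++ [:: p2, q2 & g2] = b ++ [:: p, q & g] ->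
    lex2 p' q' p2 q2 -> size g' = size g2 ->
    (weight (b2 ++ [:: p', q' & g']) < n)%N.
  by move=> e l eqs; apply: leq_trans len; rewrite -e; apply: weight_lex2.
case/lastP: g1 => [|m p0] [].
  (* Overlap: [q1] is [p]. *)
  rewrite -[[:: p1; q1]]/(rcons [:: p1] q1) -rcons_cat.
  move=> /rcons_inj[eb eqp] d1 i1; rewrite cats1 in eb; subst b q1.
  rewrite !cat_rcons in low *; rewrite redw_first //.
  rewrite (overlap_resolvable (f := fun s t u => redw (b1 ++ [:: s, t, u & g]) v)) //.
  - by apply: eq_lin_bracket => // s t _; rewrite cat_rcons.
  - move=> p' q' s' l d'; apply: IH => //; exact: low l _.
  - move=> p' q' s' l d'; rewrite -cat_rcons IH //.
      by apply: eq_lin_bracket => // s t _; rewrite cat_rcons.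
    by rewrite cat_rcons; apply: low l _.
(* Disjoint places: rewrite the first pair, then [(p, q)] by induction in the lighter words,
   exchange, and refold the first pair by induction. *)
rewrite -2!rcons_cons -rcons_cat => /rcons_inj[eb ep0] d1 i1; subst b p0.
rewrite -catA /= in low *; rewrite redw_first //.
transitivity (lin_bracket (fun s t => lin_bracket (fun s' t' =>
    redw (b1 ++ [:: s, t & m ++ [:: s', t' & g]]) v) p q) p1 q1).
  apply: eq_lin_bracket => // s t l.
  have := IH (b1 ++ [:: s, t & m]) g p q; rewrite -catA /= => -> //.
    by apply: eq_lin_bracket => // s' t' _; rewrite -catA.
  exact: low l _.
rewrite lin_bracket_exchange; apply: eq_lin_bracket => // s' t' l.
rewrite -catA /= IH //.
have := low (b1 ++ [:: p1, q1 & m]) p q g s' t' g.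
by rewrite -!catA; apply.
Qed.

(** * Reduction of multiples of a relation by biwords *)

Lemma reduction0 (r : nat) : reduction (0 : expr r) = 0.
Proof. by rewrite -[0 in LHS](subrr (0 : expr r)) reductionB subrr. Qed.

Lemma reductionD (r : nat) (E F : expr r) :
  reduction (E + F) = reduction E + reduction F.
Proof. by rewrite -[F in LHS]opprK -[- F]sub0r !reductionB reduction0 sub0r opprK. Qed.

Lemma reduction_bracket (r : nat) (b g : biword r) (p q : biletter r) :
  ddescent p q ->
  reduction (bw b * (bw [:: p; q] - bracket p q) * bw g) = 0.
Proof.
move=> d; rewrite mulrBr mulrBl reductionB; apply/eqP; rewrite subr_eq0; apply/eqP.
apply/funext => v; rewrite !bw_mul reduction_bw -catA redw_bracket //.
case: p q d => x a [y c] _; rewrite /lin_bracket /bracket /=.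
case: eqVneq => _; first by rewrite !bw_mul reduction_bw -catA.
by rewrite mulrBr mulrBl mulrDr mulrDl !bw_mul reductionB reductionD !reduction_bw -!catA.
Qed.

(** * Truncation and continuity *)

Definition truncate (r n : nat) (E : expr r) : expr r :=
  fun w => if (size w <= n)%N then E w else 0.

(** The alphabet being finite, a truncation is a finite integer combination of biwords, and
    subtraction generates all of these. *)
Lemma truncate_ind (r : nat) (P : expr r -> Prop) :
  P 0 -> (forall E F, P E -> P F -> P (E - F)) -> (forall w, P (bw w)) ->
  forall n E, P (truncate n E).
Proof.
move=> P0 PB Pbw n E.
have PN F : P F -> P (- F) by rewrite -sub0r; apply: PB.
have PD F G : P F -> P G -> P (F + G).
  by move=> PF /PN PG; rewrite -[G]opprK; apply: PB.
have -> : truncate n E = \sum_(k < n.+1) \sum_(t : k.-tuple (biletter r)) bw t *~ E t.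
  apply/funext => w; rewrite sumE /truncate; case: leqP => [lew|ltw].
    rewrite (bigD1 (Ordinal (lew : size w < n.+1)%N)) //= sumE.
    rewrite (bigD1 (in_tuple w)) //= mulrzE /bw eqxx mulr1.
    rewrite !big1 ?addr0 // => [k neq|t neq]; last first.
      rewrite mulrzE; case: eqVneq => [e|]; last by rewrite mulr0.
      by case/eqP: neq; apply: val_inj.
    rewrite sumE big1 // => t _; rewrite mulrzE.
    case: eqVneq => [e|]; last by rewrite mulr0.
    by case/eqP: neq; apply: val_inj; rewrite /= e size_tuple.
  rewrite big1 // => k _; rewrite sumE big1 // => t _; rewrite mulrzE /bw.
  case: eqVneq => [e|]; last by rewrite mulr0.
  by move: ltw (ltn_ord k); rewrite e size_tuple ltnS; case: ltngtP.
apply: (big_ind P) => // k _; apply: (big_ind P) => // t _.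
have Pn m : P (bw t *+ m) by elim: m => // m IH; rewrite mulrS; apply: PD.
by case: (E t) => m; rewrite ?NegzE ?mulrNz -?pmulrn //; apply: PN.
Qed.

(** These are the neighbourhoods that define [formal_closure]. *)
Definition eq_upto (r n : nat) (E F : expr r) : Prop :=
  forall w, (size w <= n)%N -> E w = F w.

Lemma eq_upto_truncate (r n : nat) (E : expr r) : eq_upto n E (truncate n E).
Proof. by move=> w lew; rewrite /truncate lew. Qed.

Lemma eq_upto_mul (r n : nat) (E E' F F' : expr r) :
  eq_upto n E E' -> eq_upto n F F' -> eq_upto n (E * F) (E' * F').
Proof.
move=> eE eF w lew; rewrite !mulE; apply: eq_big_nat => i lei.
rewrite eE ?eF //; first by rewrite size_drop; lia.
by move: (size_take_min i w); lia.
Qed.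

(** Reduction preserves length, hence is continuous. *)
Lemma eq_upto_reduction (r n : nat) (E F : expr r) :
  eq_upto n E F -> eq_upto n (reduction E) (reduction F).
Proof.
move=> eEF w lew; rewrite !reductionE; apply: eq_bigr => t _.
by rewrite eEF // size_tuple.
Qed.

(** * Vanishing of the reduction on the closed ideal *)

Lemma reduction_smallest (r : nat) (E : expr r) :
  smallest (@two_sided_ideal r) (@relations r) E -> reduction E = 0.
Proof.
(* Quantifying over both factors makes the set of such [F] an ideal by construction. *)
move=> JE; rewrite -[E]mul1r -[1 * E]mulr1; move: (1 : expr r) {2}1 => X Y.
have K : two_sided_ideal
    [set F : expr r | forall X Y, reduction (X * F * Y) = 0]%classic.
  split=> /= [X' Y'|F G hF hG X' Y'|F G H hG X' Y'].
  - by rewrite mulr0 mul0r reduction0.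
  - by rewrite mulrBr mulrBl reductionB hF hG subrr.
  - by rewrite !mulrA -(mulrA _ H); apply: hG.
apply: (JE _ (conj K _)) X Y => _ [p [q [d ->]]] X Y /=.
(* The coefficient at [w] sees [X] and [Y] only up to length [size w]; truncating them reduces the
   claim to biwords on either side. *)
set R := bw _ - _; apply/funext => w; rewrite zeroE; set n := size w.
rewrite (_ : _ w = reduction (truncate n X * R * truncate n Y) w); last first.
  apply: (@eq_upto_reduction _ n) => //.
  by do 2 ?apply: eq_upto_mul => //; exact: eq_upto_truncate.
suff -> : reduction (truncate n X * R * truncate n Y) = 0 by [].
apply: (truncate_ind (P := fun F => reduction (F * R * truncate n Y) = 0)).
- by rewrite !mul0r reduction0.
- by move=> F G hF hG; rewrite !mulrBl reductionB hF hG subrr.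
move=> u; apply: (truncate_ind (P := fun F => reduction (bw u * R * F) = 0)).
- by rewrite mulr0 reduction0.
- by move=> F G hF hG; rewrite [X in reduction X]mulrBr reductionB hF hG subrr.
by move=> v; apply: reduction_bracket.
Qed.

Lemma reduction_rel_ideal (r : nat) (E : expr r) :
  E \in rel_ideal r -> reduction E = 0.
Proof.
move=> /asboolP cE; apply/funext => w; have [F JF eEF] := cE (size w).
by rewrite (eq_upto_reduction eEF) // reduction_smallest.
Qed.

(** * Congruence of an expression with its reduction *)

(** A biword takes finitely many rewriting steps, each a multiple of a relation, so the difference
    lies in the ideal before closure. *)
Lemma sub_redw_smallest (r : nat) (w : biword r) :
  smallest (@two_sided_ideal r) (@relations r) (bw w - redw w).
Proof.
have [J0 JB JM] := smallest_two_sided_ideal (@relations r).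
set J := smallest _ _ in J0 JB JM *.
have JD E F : J E -> J F -> J (E + F).
  by move=> JE JF; rewrite -[F]opprK -[- F]sub0r; apply: (JB) => //; apply: JB.
have [n] := ubnP (weight w); elim: n w => // n IH w; have := first_ddP w.
case: (first_dd w) => [[[[b [x a]] [y c]] g]|i _]; last by rewrite redw_irr // subrr.
move=> [e d i] lew.
have Jrel : J (bw b * (bw [:: (x, a); (y, c)] - bracket (x, a) (y, c)) * bw g).
  by apply: JM => K [_ relK]; apply: relK; exists (x, a), (y, c).
have [lt1 lt2 lt3] := bracket_weight d.
have l1 := weight_cat_lt b g lt1.
have l2 := weight_cat_lt b g lt2.
rewrite e redw_step //; rewrite e in lew.
have J1 := IH _ (leq_trans l1 lew).
have J2 := IH _ (leq_trans l2 lew).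
move: Jrel; rewrite mulrBr mulrBl !bw_mul -catA /=.
case: eqVneq => [eac|ac].
  rewrite !bw_mul -catA /= => Jrel; have := JD _ _ Jrel J1.
  by rewrite addrA subrK.
have J3 := IH _ (leq_trans (weight_cat_lt b g (lt3 ac)) lew).
rewrite mulrBr mulrBl mulrDr mulrDl !bw_mul -!catA /= => Jrel.
have := JB _ _ (JD _ _ (JD _ _ Jrel J1) J2) J3.
set A := bw _; set B := bw _; set C := bw _; set D := bw _.
set B' := redw _; set C' := redw _; set D' := redw _.
(* The rewritten words [B], [C], [D] cancel. *)
suff -> : A - (B + C - D) + (B - B') + (C - C') - (D - D') = A - (B' + C' - D').
  by [].
by apply/funext => v; rewrite !(subE, addE); lia.
Qed.

Lemma sub_reduction_rel_ideal (r : nat) (E : expr r) :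
  E - reduction E \in rel_ideal r.
Proof.
have [J0 JB JM] := smallest_two_sided_ideal (@relations r).
apply/asboolP => n; exists (truncate n E - reduction (truncate n E)).
  apply: (truncate_ind (P := fun F => smallest _ _ (F - reduction F))).
  - by rewrite reduction0 subrr.
  - move=> F G JF JG; have := JB _ _ JF JG; rewrite reductionB !opprB.
    by rewrite addrACA [- reduction F - G]addrC addrACA.
  - by move=> w; rewrite reduction_bw; apply: sub_redw_smallest.
move=> w lew; rewrite !subE; congr (_ - _); first exact: eq_upto_truncate.
exact: (eq_upto_reduction (@eq_upto_truncate r n E)).
Qed.

(** * Normal forms in the quotient algebra *)

Lemma to_qalg_reduction (r : nat) (E : expr r) : to_qalg (reduction E) = to_qalg E.
Proof. by apply/esym/to_qalgP/sub_reduction_rel_ideal. Qed.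

(** Reduction both fixes the difference, which is irreducible, and kills it, since it lies in the
    ideal. *)
Lemma irr_to_qalg_inj (r : nat) (E F : expr r) :
  E \in irr_expr r -> F \in irr_expr r -> to_qalg E = to_qalg F -> E = F.
Proof.
move=> iE iF /to_qalgP /reduction_rel_ideal.
by rewrite reduction_id ?rpredB // => /eqP; rewrite subr_eq0 => /eqP.
Qed.

Lemma Birr_sum_coef (r : nat) (E : expr r) :
  E \in irr_expr r -> Birr_sum (fun a : Birr r => E (val a)) = E.
Proof.
move=> iE; apply/funext => w; case: (boolP (irreducible w)) => iw.
  exact: (Birr_sumE _ (Sub w iw : Birr r)).
by rewrite (irr_exprP _ iE) // (irr_exprP _ (Birr_sum_irr _)).
Qed.

Theorem theorem1 (r : nat) (hr : (2 <= r)%N) :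
  [/\ forall C : qalg r,
        exists! E : expr r, E \in irr_expr r /\ to_qalg E = C,
      [/\ bijective (@Airr_to_qalg r),
          zmod_morphism (@Airr_to_qalg r)
        & forall E F : Airr r,
            Airr_to_qalg (Airr_mul E F) = Airr_to_qalg E * Airr_to_qalg F]
    & forall C : qalg r,
        exists! c : Birr r -> int, to_qalg (Birr_sum c) = C].
Proof.
have repP (C : qalg r) : to_qalg (reduction (repr C)) = C.
  by rewrite to_qalg_reduction to_qalg_surj.
split=> [C||C].
- exists (reduction (repr C)); split.
    by split; [exact: reduction_irr | exact: repP].
  move=> E [iE eC]; apply: irr_to_qalg_inj (reduction_irr _) iE _.
  by rewrite repP eC.
- split=> [|E F|E F].
  + exists (fun C => MkAirr (reduction_irr (repr C))) => [E|C]; last exact: repP.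
    apply: val_inj; apply: irr_to_qalg_inj (reduction_irr _) (AirrP E) _.
    exact: repP.
  + exact: to_qalg_zmod.
  + by rewrite /Airr_to_qalg /= to_qalg_reduction to_qalgM.
(* The coefficients are read off the normal form; [Birr_sumE] recovers any other choice from its
   sum. *)
- exists (fun a => reduction (repr C) (val a)); split.
    by rewrite Birr_sum_coef ?reduction_irr.
  move=> c eC; apply/funext => a; rewrite -[RHS]Birr_sumE.
  rewrite (irr_to_qalg_inj (reduction_irr (repr C)) (Birr_sum_irr c)) //.
  by rewrite repP eC.
Qed.
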